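(* Let $(X,d,T)$ be a topological dynamical system. Then the pseudometrics $\tilde d_{FK}$ and $F$ on $X$ are equivalent, i.e. for every $\epsilon>0$ there is $\delta>0$ such that for all $x,y\in X$: $F(x,y)<\delta$ implies $\tilde d_{FK}(x,y)<\epsilon$, and $\tilde d_{FK}(x,y)<\delta$ implies $F(x,y)<\epsilon$.
   Context: A topological dynamical system $(X,d,T)$ consists of a compact metric space $X$ with metric $d$ and a continuous map $T:X\to X$. For $x,y\in X$, $\delta>0$ and $n\in\mathbb{N}$, an $(n,\delta)^*$-match of $x$ and $y$ is a bijection (not necessarily order-preserving) $\pi:D(\pi)\to R(\pi)$ with $D(\pi),R(\pi)\subset\{0,1,\ldots,n-1\}$ such that $d(T^ix,T^{\pi(i)}y)<\delta$ for every $i\in D(\pi)$. Let $|\pi|$ be the cardinality of $D(\pi)$. Set $$\tilde f_{n,\delta}(x,y)=1-\frac{\max\{|\pi|:\pi\text{ is an }(n,\delta)^*\text{-match of }x\text{ and }y\}}{n},\qquad \tilde f_\delta(x,y)=\limsup_{n\to+\infty}\tilde f_{n,\delta}(x,y),$$ $$\tilde d_{FK}(x,y)=\inf\{\delta>0:\tilde f_\delta(x,y)<\delta\}.$$ The weak-mean pseudometric is $$F(x,y)=\limsup_{n\to\infty}\frac1n\inf_{\sigma\in S_n}\sum_{k=0}^{n-1}d(T^kx,T^{\sigma(k)}y),$$ where $S_n$ is the set of all permutations of $\{0,1,\ldots,n-1\}$. *)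

(* Defs.v *)
From HB Require Import structures.
From mathcomp Require Import all_boot all_order all_algebra perm.
From mathcomp Require Import all_classical all_reals all_analysis.

Set Implicit Arguments.
Unset Strict Implicit.
Unset Printing Implicit Defensive.

Import Order.TTheory GRing.Theory Num.Theory.

Local Open Scope classical_set_scope.
Local Open Scope ring_scope.

Section Pseudometrics.
Context {R : realType} {X : metricType R}.
Implicit Types (T : X -> X) (x y : X) (n : nat) (delta : R).

(* A match pi : D(pi) -> R(pi) is encoded by its domain D together with a total
   function on {0, ..., n-1} that is injective on D; R(pi) is the image of D,
   and the values outside D play no role. *)
Definition is_match T n delta x y
    (D : {set 'I_n}) (pi : {ffun 'I_n -> 'I_n}) : bool :=
  dinjectiveb pi D &&
  [forall i in D, mdist (iter i T x) (iter (pi i) T y) < delta].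

Definition max_match T n delta x y : nat :=
  \max_(p : {set 'I_n} * {ffun 'I_n -> 'I_n} | is_match T delta x y p.1 p.2)
    #|p.1|.

Definition ftilde_n T n delta x y : R :=
  1 - (max_match T n delta x y)%:R / n%:R.

(* `limn_sup` is the real-valued limit superior of a bounded sequence; the
   values of `ftilde_n` lie in [0, 1].  The term n = 0, where x / 0 = 0, does
   not affect it. *)
Definition ftilde T delta x y : R :=
  limn_sup (fun n => ftilde_n T n delta x y).

(* The set is bounded below by 0 and contains every delta > 1. *)
Definition dFK T x y : R :=
  inf [set delta | 0 < delta /\ ftilde T delta x y < delta].

(* The averages are bounded since X is compact where this is used. *)
Definition weak_mean T x y : R :=
  limn_sup (fun n => n%:R^-1 *
    inf (range (fun s : 'S_n =>
      \sum_(k < n) mdist (iter k T x) (iter (s k) T y)))).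

End Pseudometrics.

Definition equivalent_pseudometrics {R : realType} {X : Type}
    (p q : X -> X -> R) : Prop :=
  forall eps : R, 0 < eps -> exists2 delta : R, 0 < delta &
    forall x y : X, (p x y < delta -> q x y < eps) /\
                    (q x y < delta -> p x y < eps).

(* Main.v *)
Require Import Defs.
From mathcomp Require Import all_boot all_order all_algebra.
From mathcomp Require Import all_classical all_reals all_analysis.
From mathcomp Require Import perm.

(** Both pseudometrics are limits superior of quantities attached to the orbit
segments of length [n], and these quantities control each other for every fixed
[n > 0]. Write [a_n] for the minimal average over permutations, [f_n] for the
proportion of indices left out by a largest match at scale [delta], and [M] for
a bound on the distance, which exists because the space is compact.

- [delta * f_n <= a_n] ([ftilde_n_le_weak_mean_n]): for any permutation [s], the
  indices [k] with [d (T^k x, T^(s k) y) < delta] form the domain of a match, so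
  at least [n * f_n] indices contribute [delta] or more to the sum. This is
  Markov's inequality.
- [a_n <= delta + M * f_n] ([weak_mean_n_le_ftilde_n]): a largest match is an
  injection defined on a subset of the indices, so it extends to a permutation
  ([perm_extension]). The matched indices cost at most [delta] on average and
  the remaining ones at most [M] each.

Passing to the limit superior, the first inequality shows that if [F < delta^2]
then [ftilde delta < delta], hence [dFK <= delta]. The second one shows that if
[dFK < c] then some [delta < c] has [ftilde delta < delta], hence
[F <= delta + M * delta < (1 + M) * c]. *)

Set Implicit Arguments.
Unset Strict Implicit.
Unset Printing Implicit Defensive.

Import Order.TTheory GRing.Theory Num.Theory.

Local Open Scope classical_set_scope.
Local Open Scope ring_scope.

(** The complements of [D] and of its image have the same size, so [f] can be
completed by matching their enumerations term by term. *)
Lemma perm_extension (I : finType) (D : {set I}) (f : I -> I) :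
  {in D &, injective f} -> exists s : {perm I}, {in D, s =1 f}.
Proof.
move=> injf; pose A := enum (~: D); pose B := enum (~: f @: D).
have szAB : size A = size B.
  rewrite -!cardE; have := cardsC D; have := cardsC (f @: D).
  by rewrite card_in_imset// => <- /addnI.
pose g i := if i \in D then f i else nth i B (index i A).
have gD i : i \in D -> g i \in f @: D.
  by move=> iD; rewrite /g iD; exact: imset_f.
have ltA i : i \notin D -> (index i A < size B)%N.
  by move=> iD; rewrite -szAB index_mem mem_enum inE.
have gND i : i \notin D -> g i \notin f @: D.
  move=> iD; rewrite /g (negbTE iD) -finset.in_setC -mem_enum.
  exact/mem_nth/ltA.
have injg : injective g.
  move=> i j gij.
  have [iD|iD] := boolP (i \in D); have [jD|jD] := boolP (j \in D).
  - by move: gij; rewrite /g iD jD; exact: injf.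
  - by have := gND j jD; rewrite -gij gD.
  - by have := gND i iD; rewrite gij gD.
  (* The default value of [nth] depends on the argument of [g]; it must be made
     the same on both sides before comparing positions. *)
  move: gij; rewrite /g (negbTE iD) (negbTE jD) (set_nth_default j) ?ltA//.
  move/eqP; rewrite nth_uniq ?enum_uniq ?ltA// => /eqP.
  by apply: index_inj; rewrite // mem_enum inE.
by exists (perm injg) => i iD; rewrite permE /g iD.
Qed.

Section LimitSuperior.
Context {R : realType}.
Implicit Types (u : nat -> R) (c M : R).

Lemma itv_bounded_fun u M : (forall n, 0 <= u n <= M) ->
  bounded_fun (u : nat -> R^o).
Proof.
move=> uM; exists M; split; first exact: num_real.
move=> c Mc n _; have /andP[u0 un] := uM n.
by rewrite /= ger0_norm// (le_trans un (ltW Mc)).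
Qed.

(** [limn_sup] is a limit of suprema of tails, a junk value when these do not
converge; boundedness turns it into the infimum of these suprema. This lemma and
the next one are all that is used of limits superior. *)
Lemma limn_sup_lt_near u c : bounded_fun (u : nat -> R^o) ->
  limn_sup u < c -> \forall n \near \oo, u n < c.
Proof.
move=> bu; rewrite limn_supE// => /inf_lt[|_ [N _ <-] supc].
  by exists (sups u 0), 0%N.
exists N => // n /= Nn; apply: le_lt_trans supc; apply: ub_le_sup.
  exact/has_ubound_sdrop/bounded_fun_has_ubound.
by exists n.
Qed.

Lemma limn_sup_le_near u c : bounded_fun (u : nat -> R^o) ->
  (\forall n \near \oo, u n <= c) -> limn_sup u <= c.
Proof.
move=> bu [N _ uc]; rewrite limn_supE//.
apply: (@le_trans _ _ (sups u N)).
  by apply: ge_inf; [exact: bounded_fun_has_lbound_sups|exists N].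
by apply: ge_sup; [exists (u N), N => /=|move=> _ [n Nn <-]; exact: uc].
Qed.

End LimitSuperior.

(** The distance to a fixed point is locally bounded, hence bounded by
compactness, and the triangle inequality through that point then bounds all
distances. *)
Lemma compact_mdist_bounded (R : realType) (X : metricType R) :
  compact [set: X] -> exists2 M : R, 0 < M & forall x y : X, mdist x y <= M.
Proof.
move=> cX; have [[x0 _]|X0] := pselect ([set: X] !=set0); last first.
  by exists 1 => // x; exfalso; apply: X0; exists x.
pose P (M : R) x := mdist x0 x < M.
have cover : \forall M \near +oo, [set: X] `<=` P M.
  apply: (proj1 (compact_near_coveringP [set: X])) => // x _.
  exists (ball x 1, [set M | mdist x0 x + 1 < M]) => /=.
    split; first exact: nbhsx_ballx.
    by exists (mdist x0 x + 1); split => //; exact: num_real.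
  move=> [y M] [/=]; rewrite ballEmdist /= => xy xM.
  apply: le_lt_trans (metric_triangle x0 x y) (lt_trans _ xM).
  by rewrite ltrD2l.
have [M [M0 dM]] : exists M : R, 0 < M /\ [set: X] `<=` P M.
  have [M0 [_ M0P]] := cover; exists (Num.max M0 0 + 1); split.
    by rewrite ltr_wpDl// le_max lexx orbT.
  apply: M0P; apply: (@le_lt_trans _ _ (Num.max M0 0)); last by rewrite ltrDl.
  by rewrite le_max lexx.
exists (M + M); first exact: addr_gt0.
move=> x y; apply: le_trans (metric_triangle x x0 y) _.
by rewrite [mdist x x0]metric_sym lerD// ltW//; exact: dM.
Qed.

Section FiniteComparison.
Context {R : realType} {X : metricType R} (T : X -> X).
Implicit Types (x y : X) (n : nat) (delta M : R).

(** [weak_mean] is the limit superior of this sequence, by definition. *)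
Definition weak_mean_n n x y : R := n%:R^-1 *
  inf (range (fun s : 'S_n =>
    \sum_(k < n) mdist (iter k T x) (iter (s k) T y))).

Lemma le_max_match n delta x y D pi :
  is_match T (n := n) delta x y D pi -> (#|D| <= max_match T n delta x y)%N.
Proof.
exact: (@leq_bigmax_cond _ _
  (fun p : {set 'I_n} * {ffun 'I_n -> 'I_n} => #|p.1|) (D, pi)).
Qed.

(** The empty match is always available, so the maximum ranges over a nonempty
family. *)
Lemma max_match_attained n delta x y : exists D pi,
  is_match T (n := n) delta x y D pi /\ max_match T n delta x y = #|D|.
Proof.
have m0 : is_match T (n := n) delta x y finset.set0 [ffun i => i].
  apply/andP; split; first by apply/dinjectiveP => i j; rewrite inE.
  by apply/forall_inP => i; rewrite inE.
rewrite /max_match (bigop.bigmax_eq_arg (finset.set0, [ffun i => i]))//.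
by case: arg_maxnP => //= -[D pi] mD _; exists D, pi.
Qed.

Lemma max_match_leq n delta x y : (max_match T n delta x y <= n)%N.
Proof.
have [D [pi [_ ->]]] := max_match_attained n delta x y.
by rewrite -[leqRHS]card_ord max_card.
Qed.

Lemma ftilde_n_itv n delta x y : 0 <= ftilde_n T n delta x y <= 1.
Proof.
rewrite /ftilde_n subr_ge0 gerBl divr_ge0// andbT.
case: n => [|n]; first by rewrite invr0 mulr0.
by rewrite ler_pdivrMr ?ltr0n// mul1r ler_nat max_match_leq.
Qed.

Lemma ftilde_nE n delta x y : (0 < n)%N ->
  ftilde_n T n delta x y = n%:R^-1 * (n - max_match T n delta x y)%:R.
Proof.
move=> n0; rewrite /ftilde_n natrB ?max_match_leq// mulrBr.
rewrite mulVf ?pnatr_eq0 -?lt0n//.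
by rewrite [_ / _]mulrC.
Qed.

Lemma weak_mean_n_ge n x y c : (0 < n)%N ->
  (forall s : 'S_n,
    n%:R * c <= \sum_(k < n) mdist (iter k T x) (iter (s k) T y)) ->
  c <= weak_mean_n n x y.
Proof.
move=> n0 cs; rewrite /weak_mean_n ler_pdivlMl ?ltr0n//.
apply: lb_le_inf; first by eexists; exists 1%g.
by move=> _ [s _ <-].
Qed.

Lemma weak_mean_n_le n x y (s : 'S_n) :
  weak_mean_n n x y <=
  n%:R^-1 * \sum_(k < n) mdist (iter k T x) (iter (s k) T y).
Proof.
rewrite ler_wpM2l ?invr_ge0//; apply: ge_inf; last by exists s.
by exists 0 => _ [t _ <-]; apply: sumr_ge0 => k _; exact: mdist_ge0.
Qed.

(** Markov's inequality: the indices at which a permutation pairs points at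
distance less than [delta] are the domain of a match, so at least
[n - max_match] summands are [>= delta]. *)
Lemma ftilde_n_le_weak_mean_n n delta x y : 0 < delta -> (0 < n)%N ->
  delta * ftilde_n T n delta x y <= weak_mean_n n x y.
Proof.
move=> d0 n0.
apply: weak_mean_n_ge => // s.
rewrite ftilde_nE// mulrCA mulVKf ?pnatr_eq0 -?lt0n//.
pose D := finset (fun k : 'I_n => mdist (iter k T x) (iter (s k) T y) < delta).
have mD : is_match T delta x y D (finfun s).
  apply/andP; split; last by apply/forall_inP => k; rewrite inE ffunE.
  by apply/dinjectiveP => i j _ _; rewrite !ffunE; exact: perm_inj.
apply: (@le_trans _ _ (delta * (#|~: D|)%:R)).
  rewrite ler_wpM2l ?(ltW d0)// ler_nat leq_subLR.
  by rewrite -[leqLHS](card_ord n) -(cardsC D) leq_add2r (le_max_match mD).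
rewrite (bigID (mem D)) /= mulr_natr -sumr_const ler_wpDl//.
  by apply: sumr_ge0 => k _; exact: mdist_ge0.
rewrite (eq_bigl (fun k => k \notin D)) => [|k]; last by rewrite finset.in_setC.
by apply: ler_sum => k; rewrite inE -leNgt.
Qed.

(** Extend a largest match to a permutation: matched indices cost less than
[delta], and each of the others at most [M]. *)
Lemma weak_mean_n_le_ftilde_n n delta M x y : 0 <= delta ->
  (forall x y : X, mdist x y <= M) -> (0 < n)%N ->
  weak_mean_n n x y <= delta + M * ftilde_n T n delta x y.
Proof.
move=> d0 dM n0; have [D [pi [/andP[/dinjectiveP inj /forall_inP mD] maxE]]] :=
  max_match_attained n delta x y.
have [s sE] := perm_extension inj.
apply: le_trans (weak_mean_n_le _ _ s) _.
rewrite ftilde_nE// maxE mulrCA.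
rewrite -[delta](mulKf (lt0r_neq0 _ : n%:R != 0)) ?ltr0n//.
rewrite -mulrDr ler_wpM2l ?invr_ge0// (bigID (mem D)) /= lerD//.
  apply: (@le_trans _ _ (\sum_(k in D) delta)).
    by apply: ler_sum => k kD; rewrite sE// ltW// mD.
  rewrite sumr_const -[leLHS]mulr_natl ler_wpM2r// ler_nat.
  by rewrite -[leqRHS]card_ord max_card.
apply: (@le_trans _ _ (\sum_(k in ~: D) M)).
  rewrite [leRHS](eq_bigl (fun k => k \notin D)) => [|k].
    by apply: ler_sum => k _; exact: dM.
  by rewrite finset.in_setC.
rewrite sumr_const mulr_natr -[X in (X - _)%N](card_ord n) -(cardsC D).
by rewrite addKn.
Qed.

End FiniteComparison.

Section Limits.
Context {R : realType} {X : metricType R} (T : X -> X).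
Implicit Types (x y : X) (delta : R).

Lemma dFK_le delta x y : 0 < delta -> ftilde T delta x y < delta ->
  dFK T x y <= delta.
Proof.
by move=> d0 fd; apply: ge_inf; first by exists 0 => r [/ltW].
Qed.

Lemma ftilde_n_bounded delta x y :
  bounded_fun ((fun n => ftilde_n T n delta x y) : nat -> R^o).
Proof.
exact: (@itv_bounded_fun _ _ 1 (fun n => ftilde_n_itv T n delta x y)).
Qed.

(** The infimum defining [dFK] is over a nonempty set, since [ftilde_n <= 1]
puts every [delta > 1] in it. *)
Lemma dFK_lt c x y : dFK T x y < c ->
  exists delta, [/\ 0 < delta, delta < c & ftilde T delta x y < delta].
Proof.
move=> /inf_lt[|delta [d0 fd] dc]; last by exists delta.
exists 2; split => //; apply: (@le_lt_trans _ _ 1); last by rewrite ltr1n.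
apply: limn_sup_le_near; first exact: ftilde_n_bounded.
by apply: nearW => n; case/andP: (ftilde_n_itv T n 2 x y).
Qed.

Lemma weak_mean_n_bounded M x y : (forall x y : X, mdist x y <= M) ->
  bounded_fun ((fun n => weak_mean_n T n x y) : nat -> R^o).
Proof.
move=> dM; have M0 : 0 <= M := le_trans (mdist_ge0 x y) (dM x y).
apply: (@itv_bounded_fun _ _ M) => -[|n].
  by rewrite /weak_mean_n invr0 mul0r lexx.
apply/andP; split.
  apply: weak_mean_n_ge => // s; rewrite mulr0.
  by apply: sumr_ge0 => k _; exact: mdist_ge0.
apply: le_trans (weak_mean_n_le _ _ _ 1%g) _.
rewrite ler_pdivrMl ?ltr0n// mulr_natl -[n.+1 in leRHS]card_ord -sumr_const.
by apply: ler_sum => k _; exact: dM.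
Qed.

End Limits.

Theorem theorem3p2 (R : realType) (X : metricType R) (T : X -> X)
    (compactX : compact [set: X]) (continuousT : continuous T) :
  equivalent_pseudometrics (weak_mean T) (dFK T).
Proof.
have [M M0 dM] := compact_mdist_bounded compactX.
move=> eps eps0; pose d1 := eps / 2; pose d2 := eps / (1 + M).
have d1_gt0 : 0 < d1 by rewrite divr_gt0.
have M1 : 0 < 1 + M by rewrite addr_gt0.
have d2_gt0 : 0 < d2 by rewrite divr_gt0.
(* [d1 ^ 2] gives the bound on [dFK] by Markov's inequality; [d2] makes
   [delta + M * delta < eps] for all [delta < d2]. *)
exists (Num.min (d1 * d1) d2); first by rewrite lt_min d2_gt0 mulr_gt0.
move=> x y; rewrite !lt_min; split=> /andP[].
  move=> Fd _; apply: (@le_lt_trans _ _ d1); last first.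
    by rewrite /d1 ltr_pdivrMr// ltr_pMr// ltr1n.
  (* Membership in the set defining [dFK] is strict, while eventual bounds only
     give a weak inequality between limits superior; the midpoint [c] leaves the
     room needed. *)
  apply: dFK_le => //; pose c := (weak_mean T x y + d1 * d1) / 2.
  have [Fc cd] := midf_lt Fd.
  apply: (@le_lt_trans _ _ (c / d1)); last by rewrite ltr_pdivrMr.
  apply: limn_sup_le_near; first exact: ftilde_n_bounded.
  have := limn_sup_lt_near (weak_mean_n_bounded T x y dM) Fc.
  apply: filterS2 (nbhs_infty_gt 0) => n n0 ac.
  rewrite ler_pdivlMr// mulrC.
  exact: le_trans (ftilde_n_le_weak_mean_n T x y d1_gt0 n0) (ltW ac).
move=> _ /dFK_lt[delta [d0 dd fd]].
apply: (@le_lt_trans _ _ (delta + M * delta)); last first.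
  by rewrite -{1}[delta]mul1r -mulrDl mulrC -ltr_pdivlMr.
apply: limn_sup_le_near; first exact: (weak_mean_n_bounded T x y dM).
have := limn_sup_lt_near (ftilde_n_bounded T delta x y) fd.
apply: filterS2 (nbhs_infty_gt 0) => n n0 fnd.
apply: le_trans (weak_mean_n_le_ftilde_n T x y (ltW d0) dM n0) _.
by rewrite lerD2l ler_pM2l// ltW.
Qed.
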